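(* Let $B\in\mathcal{B}$ and let $x^\circ$ be a feasible solution for $\mathcal{IP}$ such that $x^\circ_B>\mathbf{0}$ (componentwise). Then $\mathit{IFR}(\mathcal{LP},x^\circ)\subseteq\mathit{IFR}(\mathcal{G}^B,x^\circ)$.
   Context: Let $m\le n$, let $A\in\mathbb{Z}^{m\times n}$ have full row rank, and let $b\in\mathbb{Z}^m$, $c\in\mathbb{R}^n$. The integer program $\mathcal{IP}$ is $\min\{c^\intercal x\mid Ax=b,\ x\ge\mathbf{0},\ x\in\mathbb{Z}^n\}$, assumed to have nonempty feasible region; its LP relaxation $\mathcal{LP}$ is $\min\{c^\intercal x\mid Ax=b,\ x\ge\mathbf{0},\ x\in\mathbb{R}^n\}$. A basis is a set $B\subseteq\{1,\dots,n\}$ with $|B|=m$ such that the submatrix $A_B$ of columns indexed by $B$ is nonsingular; $N=\{1,\dots,n\}\setminus B$, $A_N$ is the submatrix of columns indexed by $N$, and for a vector $v\in\mathbb{R}^n$, $v_B,v_N$ are its subvectors indexed by $B,N$. The basis $B$ is feasible for $\mathcal{LP}$ if $A_B^{-1}b\ge\mathbf{0}$. $\mathcal{B}$ denotes the finite set of all feasible bases of $\mathcal{LP}$. The Gomory corner relaxation $\mathcal{G}^B$ of $\mathcal{IP}$ with respect to $B$ is $\min\{c_B^\intercal x_B+c_N^\intercal x_N\mid A_Bx_B+A_Nx_N=b,\ x_N\ge\mathbf{0},\ x\in\mathbb{Z}^n\}$ (the nonnegativity of $x_B$ is dropped). For $d\in\mathbb{R}^n$ and $\mathcal{P}\in\{\mathcal{LP},\mathcal{G}^B\}$,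 $\mathcal{P}^d$ is the problem $\mathcal{P}$ with objective vector $c$ replaced by $d$. For a feasible solution $x^\circ$ of $\mathcal{P}$, the inverse-feasible region $\mathit{IFR}(\mathcal{P},x^\circ)$ is the set of all $d\in\mathbb{R}^n$ such that $x^\circ$ is an optimal solution for $\mathcal{P}^d$. *)

(* Defs.v *)
From mathcomp Require Import all_boot all_order all_algebra.
From mathcomp Require Import all_classical reals.

Set Implicit Arguments.
Unset Strict Implicit.
Unset Printing Implicit Defensive.

Import Order.TTheory GRing.Theory Num.Theory.

Local Open Scope classical_set_scope.
Local Open Scope ring_scope.

(* The columns of A, resp. the coordinates of v, with index in S, in increasing
   order of the index; the result has dimension #|S|. *)
Definition subcols (T : Type) (m n : nat) (A : 'M[T]_(m, n)) (S : {set 'I_n}) :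
    'M[T]_(m, #|S|) :=
  colsub (@enum_val _ (mem S)) A.

Definition subvec (T : Type) (n : nat) (v : 'cV[T]_n) (S : {set 'I_n}) :
    'cV[T]_#|S| :=
  rowsub (@enum_val _ (mem S)) v.

Definition dotv (R : realType) (n : nat) (u v : 'cV[R]_n) : R :=
  (u^T *m v) 0 0.

Record min_problem (R : realType) (n : nat) := MinProblem {
  objective : 'cV[R]_n -> R;
  feasible : set 'cV[R]_n
}.

Definition optimal (R : realType) (n : nat) (P : min_problem R n)
    (x : 'cV[R]_n) : Prop :=
  feasible P x /\ forall y, feasible P y -> objective P x <= objective P y.

Definition IP (R : realType) (m n : nat) (A : 'M[int]_(m, n)) (b : 'cV[int]_m)
    (c : 'cV[R]_n) : min_problem R n :=
  MinProblem (fun x => dotv c x)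
    [set x | [/\ map_mx intr A *m x = map_mx intr b,
                 x \is a mxOver Num.nneg & x \is a mxOver Num.int]].

Definition LP (R : realType) (m n : nat) (A : 'M[int]_(m, n)) (b : 'cV[int]_m)
    (c : 'cV[R]_n) : min_problem R n :=
  MinProblem (fun x => dotv c x)
    [set x | map_mx intr A *m x = map_mx intr b /\ x \is a mxOver Num.nneg].

(* The square matrix A_B over R; the cast only identifies 'I_#|B| with 'I_m. *)
Definition basis_mx (R : realType) (m n : nat) (A : 'M[int]_(m, n))
    (B : {set 'I_n}) (cardB : #|B| = m) : 'M[R]_m :=
  castmx (erefl m, cardB) (map_mx intr (subcols A B)).

Definition feasible_bases (R : realType) (m n : nat) (A : 'M[int]_(m, n))
    (b : 'cV[int]_m) : set {set 'I_n} :=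
  [set B : {set 'I_n} | exists cardB : #|B| = m,
     basis_mx R A cardB \in unitmx /\
     invmx (basis_mx R A cardB) *m map_mx intr b \is a mxOver Num.nneg].

Definition gomory_corner (R : realType) (m n : nat) (A : 'M[int]_(m, n))
    (b : 'cV[int]_m) (B : {set 'I_n}) (c : 'cV[R]_n) : min_problem R n :=
  let N := ~: B in
  MinProblem
    (fun x => dotv (subvec c B) (subvec x B) + dotv (subvec c N) (subvec x N))
    [set x | [/\ map_mx intr (subcols A B) *m subvec x B +
                 map_mx intr (subcols A N) *m subvec x N = map_mx intr b,
                 subvec x N \is a mxOver Num.nneg & x \is a mxOver Num.int]].

(* A problem is passed as a function of its objective vector, so that P d is
   the problem with objective vector d. *)
Definition IFR (R : realType) (n : nat) (P : 'cV[R]_n -> min_problem R n)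
    (x0 : 'cV[R]_n) : set 'cV[R]_n :=
  [set d | optimal (P d) x0].

(* Main.v *)
Require Import Defs.
From mathcomp Require Import all_boot all_order all_algebra.
From mathcomp Require Import all_classical reals.

(** Let [d] be an objective for which [x0] is LP-optimal and let [y] be feasible
    for the corner relaxation.  The only constraints of the linear relaxation
    that [y] may violate are sign constraints on basic coordinates, and these
    are slack at [x0].  Hence a short step from [x0] towards [y] stays feasible
    for the linear relaxation ([short_step_ge0]), so LP-optimality of [x0] makes
    [y - x0] a direction in which [d] does not decrease, and the full step to
    [y] cannot improve the objective either.  The block form of the corner
    relaxation is related to the plain matrix form of the linear one by
    [mul_subcols_subvec]. *)

Import Order.TTheory GRing.Theory Num.Theory.

Local Open Scope classical_set_scope.
Local Open Scope ring_scope.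

Lemma mul_subcols_subvec {S : pzSemiRingType} {m n : nat} (M : 'M[S]_(m, n))
    (x : 'cV[S]_n) (B : {set 'I_n}) :
  subcols M B *m subvec x B + subcols M (~: B) *m subvec x (~: B) = M *m x.
Proof.
apply/matrixP => i j; rewrite !mxE (bigID (mem B)) /=.
rewrite [X in _ = X + _]big_enum_val; congr (_ + _).
  by apply: eq_bigr => k _; rewrite !mxE.
rewrite [RHS](eq_bigl (mem (~: B))) => [|k]; last by rewrite /= finset.in_setC.
by rewrite [RHS]big_enum_val; apply: eq_bigr => k _; rewrite !mxE.
Qed.

Lemma dotv_subvec {R : realType} {n : nat} (c x : 'cV[R]_n) (B : {set 'I_n}) :
  dotv (subvec c B) (subvec x B) + dotv (subvec c (~: B)) (subvec x (~: B))
  = dotv c x.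
Proof.
rewrite /dotv -(mul_subcols_subvec _ x B) [RHS]mxE.
by rewrite /subcols /subvec !trmx_mxsub.
Qed.

Lemma subvec_mxOverP {T : Type} {S : {pred T}} {n : nat} {x : 'cV[T]_n}
    {B : {set 'I_n}} :
  reflect (forall i, i \in B -> x i 0 \in S) (subvec x B \is a mxOver S).
Proof.
apply: (iffP mxOverP) => [xS i iB|xS k j].
  by have := xS (enum_rank_in iB i) 0; rewrite mxE enum_rankK_in.
by rewrite mxE (ord1 j); apply: xS; apply: enum_valP.
Qed.

(** One step length works for all coordinates at once, as there are finitely
    many of them. *)
Lemma short_step_ge0 {R : realFieldType} {n : nat} (x y : 'cV[R]_n) :
  (forall i, 0 <= x i 0) -> (forall i, 0 < x i 0 \/ 0 <= y i 0) ->
  exists2 e : R, 0 < e & x + e *: (y - x) \is a mxOver Num.nneg.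
Proof.
move=> x_ge0 xy.
(* The inverse of the step must be at least 1 and, where [x] is positive, at
   least 1 + |y i| / x i; terms with [x j 0 = 0] vanish since 0^-1 = 0. *)
pose s := 1 + \sum_j `|y j 0| / x j 0.
have t_ge0 j : 0 <= `|y j 0| / x j 0 by rewrite divr_ge0.
have s_ge1 : 1 <= s by rewrite lerDl sumr_ge0.
have s_gt0 : 0 < s by apply: lt_le_trans s_ge1.
exists s^-1; first by rewrite invr_gt0.
apply/mxOverP => i j; rewrite (ord1 j) !mxE nnegrE.
rewrite -(pmulr_rge0 _ s_gt0) mulrDr mulVKf ?gt_eqF//.
case: (xy i) => [xi_gt0|yi_ge0]; last first.
  by rewrite addrCA addr_ge0// -[X in _ - X]mul1r -mulrBl mulr_ge0// subr_ge0.
have : (1 + `|y i 0| / x i 0) * x i 0 <= s * x i 0.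
  rewrite ler_pM2r// lerD2l (bigD1 i)//= lerDl.
  by apply: sumr_ge0.
rewrite mulrDl mul1r divfK ?gt_eqF// => sx_ge.
rewrite addrCA -lerBlDl sub0r lerBrDl (le_trans _ sx_ge)// lerD2l.
by rewrite -normrN ler_norm.
Qed.

Theorem theorem2 (R : realType) (m n : nat) (hmn : (m <= n)%N)
    (A : 'M[int]_(m, n)) (b : 'cV[int]_m) (c : 'cV[R]_n)
    (hA : \rank (map_mx intr A : 'M[R]_(m, n)) = m)
    (hIP : feasible (IP A b c) !=set0)
    (B : {set 'I_n}) (hB : feasible_bases R A b B)
    (x0 : 'cV[R]_n) (hx0 : feasible (IP A b c) x0)
    (hx0B : subvec x0 B \is a mxOver Num.pos) :
  IFR (LP A b) x0 `<=` IFR (gomory_corner A b B) x0.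
Proof.
case: hx0 => Ax0 /mxOverP x0_ge0 x0_int d [_ x0_opt].
have AE (x : 'cV[R]_n) : map_mx intr (subcols A B) *m subvec x B +
    map_mx intr (subcols A (~: B)) *m subvec x (~: B) = map_mx intr A *m x.
  by rewrite -(mul_subcols_subvec _ x B) /subcols !map_mxsub.
split=> [|y /= [Ay /subvec_mxOverP yN_ge0 _]].
  by split=> //=; [rewrite AE | apply/subvec_mxOverP => i _; apply: x0_ge0].
rewrite AE in Ay; rewrite !dotv_subvec.
have [||e e_gt0 xe_ge0] := short_step_ge0 x0 y.
- by move=> i; have := x0_ge0 i 0; rewrite nnegrE.
- move=> i; have [iB|iNB] := boolP (i \in B).
    by left; move/subvec_mxOverP: hx0B => /(_ i iB); rewrite posrE.
  by right; rewrite -nnegrE; apply: yN_ge0; rewrite finset.in_setC.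
have stepE p (M : 'M[R]_(p, n)) :
    M *m (x0 + e *: (y - x0)) = M *m x0 + e *: (M *m y - M *m x0).
  by rewrite mulmxDr -scalemxAr mulmxBr.
have /= := x0_opt (x0 + e *: (y - x0)).
rewrite /dotv !stepE Ax0 Ay subrr scaler0 addr0 => /(_ (conj erefl xe_ge0)).
move: (d^T *m x0) (d^T *m y) => u v.
by rewrite !mxE lerDl pmulr_rge0// subr_ge0.
Qed.
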